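(* Let $V_1,W_1\in[0,1)$ and let $$Q_1:=\frac{V_1(1+W_1)}{2W_1},$$ where $Q_1:=+\infty$ if $V_1\neq0$ and $W_1=0$, and $Q_1$ can be chosen arbitrarily if $V_1=0$ and $W_1=0$. The function $G^{\max}_{V_1W_1}:\mathbb{R}\to\mathbb{R}$ is $\pi$-periodic, even, and oscillates monotonically between the values $$\max_{\gamma\in\mathbb{R}}G^{\max}_{V_1W_1}(\gamma)=\sqrt{\frac{(1+V_1)(1+W_1)}{2(1-V_1)}}$$ and $$\min_{\gamma\in\mathbb{R}}G^{\max}_{V_1W_1}(\gamma)=\begin{cases}\sqrt{\dfrac{(1-V_1^2)(1+W_1)}{2(1-Q_1V_1)}}&\text{if }Q_1\le1,\\[3mm]\sqrt{\dfrac{(1+V_1)(1-W_1)}{2(1-V_1)}}&\text{if }Q_1\geq1.\end{cases}$$ The maximum value is achieved if $\gamma$ is an odd multiple of $\frac{\pi}{2}$ and the minimum value is achieved if $\gamma$ is a multiple of $\pi$. The function $G^{\min}_{V_1W_1}:\mathbb{R}\to\mathbb{R}$ is $\pi$-periodic, even, and oscillates monotonically between the values $$\max_{\gamma\in\mathbb{R}}G^{\min}_{V_1W_1}(\gamma)=\sqrt{\frac{1+W_1}{2}}\quad\text{and}\quad\min_{\gamma\in\mathbb{R}}G^{\min}_{V_1W_1}(\gamma)=\begin{cases}\sqrt{\dfrac{(1-V_1)(1+W_1)}{2(1+V_1)}}&\text{if }V_1\le W_1,\\[3mm]\sqrt{\dfrac{1-W_1}{2}}&\text{if }V_1\ge W_1.\end{cases}$$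 The maximum value is achieved if $\gamma$ is a multiple of $\pi$ and the minimum value is achieved if $\gamma$ is an odd multiple of $\frac{\pi}{2}$.
   Context: For $V,W\in[0,1)$: $f_{VW}(\alpha,x):=\dfrac{1+V\cos(x+\alpha)}{1-W\cos\alpha}$, $f^{\max}_{VW}(x):=\max_{\alpha\in\mathbb{R}}f_{VW}(\alpha,x)$, $H_{VW}(x,\beta):=\dfrac{f^{\max}_{VW}(x)}{1+V\cos(x+\beta)}$, $H^{\max}_{VW}(\beta):=\max_{x\in\mathbb{R}}H_{VW}(x,\beta)$, $H^{\min}_{VW}(\beta):=\min_{x\in\mathbb{R}}H_{VW}(x,\beta)$. Then $G^{\max}_{V_1W_1}(\gamma):=\sqrt{\frac{1-W_1^2}{2}H^{\max}_{V_1W_1}(2\gamma)}$ and $G^{\min}_{V_1W_1}(\gamma):=\sqrt{\frac{1-W_1^2}{2}H^{\min}_{V_1W_1}(2\gamma)}$, $\gamma\in\mathbb{R}$. ''Oscillates monotonically between its extreme values'' means: on each closed interval whose endpoints are two consecutive points among those listed as achieving the maximum and the minimum, the function is monotone (not necessarily strictly), going from the maximum value to the minimum value or vice versa. *)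

(* Defs.v *)
From Stdlib Require Import Reals ZArith ClassicalEpsilon.
From Coquelicot Require Import Rbar.
Open Scope R_scope.

Definition attains_max (f : R -> R) (x : R) : Prop := forall y, f y <= f x.
Definition attains_min (f : R -> R) (x : R) : Prop := forall y, f x <= f y.

Definition is_max (f : R -> R) (m : R) : Prop :=
  exists x, attains_max f x /\ f x = m.
Definition is_min (f : R -> R) (m : R) : Prop :=
  exists x, attains_min f x /\ f x = m.

(* The value is unspecified when the extremum is not attained; for parameters
   in [0,1) every function to which these are applied below is continuous and
   2 PI-periodic, so that its extrema are attained. *)
Definition max_of (f : R -> R) : R := epsilon (inhabits 0) (is_max f).
Definition min_of (f : R -> R) : R := epsilon (inhabits 0) (is_min f).

Definition f_VW (V W alpha x : R) : R :=
  (1 + V * cos (x + alpha)) / (1 - W * cos alpha).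

Definition fmax (V W x : R) : R := max_of (fun alpha => f_VW V W alpha x).

Definition H (V W x beta : R) : R := fmax V W x / (1 + V * cos (x + beta)).

Definition Hmax (V W beta : R) : R := max_of (fun x => H V W x beta).
Definition Hmin (V W beta : R) : R := min_of (fun x => H V W x beta).

Definition Gmax (V W gamma : R) : R :=
  sqrt ((1 - W ^ 2) / 2 * Hmax V W (2 * gamma)).
Definition Gmin (V W gamma : R) : R :=
  sqrt ((1 - W ^ 2) / 2 * Hmin V W (2 * gamma)).

(* No constraint when V = W = 0: there Q is an arbitrary element of Rbar. *)
Definition is_Q1 (V W : R) (Q : Rbar) : Prop :=
  (W <> 0 -> Q = Finite (V * (1 + W) / (2 * W))) /\
  (W = 0 -> V <> 0 -> Q = p_infty).

Definition periodic (T : R) (f : R -> R) : Prop := forall x, f (x + T) = f x.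
Definition even_fun (f : R -> R) : Prop := forall x, f (- x) = f x.

Definition multiple_PI (x : R) : Prop := exists k : Z, x = IZR k * PI.
Definition odd_multiple_PI2 (x : R) : Prop :=
  exists k : Z, x = IZR (2 * k + 1) * (PI / 2).

Definition nondecreasing_on (a b : R) (f : R -> R) : Prop :=
  forall x y, a <= x -> x <= y -> y <= b -> f x <= f y.
Definition nonincreasing_on (a b : R) (f : R -> R) : Prop :=
  forall x y, a <= x -> x <= y -> y <= b -> f y <= f x.

Definition consecutive (S : R -> Prop) (a b : R) : Prop :=
  S a /\ S b /\ a < b /\ forall c, a < c < b -> ~ S c.

(* [Smax] and [Smin] are the points listed as achieving the maximum and the
   minimum of [f]. *)
Definition oscillates_monotonically (f : R -> R) (Smax Smin : R -> Prop) : Prop :=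
  forall a b, consecutive (fun x => Smax x \/ Smin x) a b ->
    (nondecreasing_on a b f /\ attains_min f a /\ attains_max f b) \/
    (nonincreasing_on a b f /\ attains_max f a /\ attains_min f b).

(* Main.v *)
(* Maximising over [alpha] gives [(1 - W^2) f^max(x) = peak (cos x)] with [peak]
   explicit and increasing, so [H] is an increasing function of [cos x] over a
   decreasing function of [cos (x + beta)].  A two-point argument on the circle
   (if [cos b' <= cos b], then every pair [x, x + b] can be replaced by a pair
   [x', x' + b'] with larger [cos x'] and smaller [cos (x' + b')], or vice versa)
   shows that [H^max] and [H^min] are monotone functions of [cos beta].  Hence
   the extrema of [G] are at [beta = 0] and [beta = PI]; there they are extrema
   over [c = cos x] of [peak c / (1 + V c)] or [peak c / (1 - V c)], which are
   decided by the quadratic equation of which [peak c] is the larger root. *)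
Require Import Defs.
From Stdlib Require Import Reals Lra Lia Psatz ZArith ClassicalEpsilon.
From Coquelicot Require Import Rbar.
Open Scope R_scope.

(** * Extremal values: uniqueness, and existence for continuous functions on the circle *)

Lemma is_max_unique (f : R -> R) (m m' : R) : is_max f m -> is_max f m' -> m = m'.
Proof.
  intros [x [Hx <-]] [y [Hy <-]].
  apply Rle_antisym; auto.
Qed.

Lemma is_min_unique (f : R -> R) (m m' : R) : is_min f m -> is_min f m' -> m = m'.
Proof.
  intros [x [Hx <-]] [y [Hy <-]].
  apply Rle_antisym; auto.
Qed.

Lemma max_of_eq (f : R -> R) (m : R) : is_max f m -> max_of f = m.
Proof.
  intros Hm. apply (is_max_unique f); [|exact Hm].
  unfold max_of. apply epsilon_spec. now exists m.
Qed.

Lemma min_of_eq (f : R -> R) (m : R) : is_min f m -> min_of f = m.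
Proof.
  intros Hm. apply (is_min_unique f); [|exact Hm].
  unfold min_of. apply epsilon_spec. now exists m.
Qed.

(** The sign of [b] chooses between [acos a] and its opposite. The bound on [z] provides the compact
    interval of [circle_is_max]. *)
Lemma unit_vector_angle (a b : R) :
  a ^ 2 + b ^ 2 = 1 -> exists z, - PI <= z <= PI /\ cos z = a /\ sin z = b.
Proof.
  intros Hab.
  assert (Ha : -1 <= a <= 1) by nra.
  assert (Hz := acos_bound a).
  assert (Hs : sin (acos a) = Rabs b).
  { rewrite sin_acos by exact Ha.
    replace (1 - Rsqr a) with (Rsqr b) by (unfold Rsqr; lra).
    apply sqrt_Rsqr_abs. }
  destruct (Rle_dec 0 b) as [Hb | Hb].
  - exists (acos a). rewrite Hs, cos_acos by exact Ha.
    rewrite Rabs_pos_eq by exact Hb. lra.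
  - exists (- acos a). rewrite cos_neg, sin_neg, Hs, cos_acos by exact Ha.
    rewrite Rabs_left by lra. lra.
Qed.

(** Periodicity is phrased as dependence on [cos] and [sin] only, so [unit_vector_angle] brings any
    [y] into [[- PI, PI]] with no multiple of [2 PI] to count. *)
Lemma circle_is_max (f : R -> R) :
  continuity f ->
  (forall x y, cos x = cos y -> sin x = sin y -> f x = f y) ->
  exists m, is_max f m.
Proof.
  intros Hcont Hper.
  assert (HPI := PI_RGT_0).
  destruct (continuity_ab_maj f (- PI) PI) as [x [Hx _]]; [lra | auto |].
  exists (f x), x. split; [|reflexivity].
  intros y.
  destruct (unit_vector_angle (cos y) (sin y)) as [z [Hz [Hc Hs]]].
  { generalize (sin2_cos2 y). unfold Rsqr. lra. }
  rewrite <- (Hper z y Hc Hs). auto.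
Qed.

Lemma circle_is_min (f : R -> R) :
  continuity f ->
  (forall x y, cos x = cos y -> sin x = sin y -> f x = f y) ->
  exists m, is_min f m.
Proof.
  intros Hcont Hper.
  destruct (circle_is_max (fun x => - f x)) as [m [x [Hx _]]].
  - exact (continuity_opp f Hcont).
  - intros x y Hc Hs. now rewrite (Hper x y Hc Hs).
  - exists (f x), x. split; [|reflexivity].
    intros y. specialize (Hx y). simpl in Hx. lra.
Qed.

(** * Moving pairs of points on the circle *)

(* Replacing [x] and [x + d] by their absolute values modulo [2 PI], of sum at
   least [d'], both can be scaled towards [0], on opposite sides, until they
   are [d'] apart. *)
Lemma closer_pair (d d' : R) : cos d <= cos d' ->
  forall x, exists x', cos x <= cos x' /\ cos (x + d) <= cos (x' + d').
Proof.
  intros Hd x.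
  set (y := x + d).
  assert (Hcb : forall t, -1 <= cos t <= 1) by (intro; apply COS_bound).
  set (a := acos (cos x)). set (b := acos (cos y)). set (e := acos (cos d')).
  assert (Ha : 0 <= a <= PI) by apply acos_bound.
  assert (Hb : 0 <= b <= PI) by apply acos_bound.
  assert (He : 0 <= e <= PI) by apply acos_bound.
  assert (Hca : cos a = cos x) by (apply cos_acos; auto).
  assert (Hcb' : cos b = cos y) by (apply cos_acos; auto).
  assert (Hce : cos e = cos d') by (apply cos_acos; auto).
  assert (Hsa := sin_ge_0 a (proj1 Ha) (proj2 Ha)).
  assert (Hsb := sin_ge_0 b (proj1 Hb) (proj2 Hb)).
  (* Up to sign and modulo [2 PI], [a] is [x] and [b] is [y]. So [cos d] is [cos (a - b)] or
     [cos (a + b)], and the latter is the smaller since both sines are nonnegative. *)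
  assert (Hle : e <= a + b).
  { destruct (Rle_dec (a + b) PI) as [Hab | Hab]; [|lra].
    apply cos_decr_0; try lra.
    rewrite Hce. apply Rle_trans with (2 := Hd).
    replace d with (y - x) by (unfold y; ring).
    rewrite cos_plus, cos_minus, Hca, Hcb'.
    assert (Hx2 := sin2_cos2 x). assert (Hy2 := sin2_cos2 y).
    assert (Ha2 := sin2_cos2 a). assert (Hb2 := sin2_cos2 b).
    rewrite Hca in Ha2. rewrite Hcb' in Hb2. unfold Rsqr in *.
    assert (Hxa : (sin x)² = (sin a)²) by (unfold Rsqr; lra).
    assert (Hyb : (sin y)² = (sin b)²) by (unfold Rsqr; lra).
    apply Rsqr_eq in Hxa; apply Rsqr_eq in Hyb.
    assert (0 <= sin a * sin b) by nra.
    destruct Hxa as [-> | ->], Hyb as [-> | ->]; lra. }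
  assert (Hl : exists l, 0 <= l <= 1 /\ l * (a + b) = e).
  { destruct (Req_dec (a + b) 0) as [H0 | H0].
    - exists 0. lra.
    - assert (Hp : 0 < a + b) by lra.
      exists (e / (a + b)). split; [split|].
      + apply Rle_mult_inv_pos; lra.
      + apply (Rmult_le_reg_r (a + b)); [exact Hp|].
        unfold Rdiv. rewrite Rmult_assoc, Rinv_l by lra. lra.
      + now field. }
  destruct Hl as [l [Hl Hle']].
  assert (Hxa : cos x <= cos (- (l * a))).
  { rewrite cos_neg, <- Hca. apply cos_decr_1; nra. }
  assert (Hyb : cos y <= cos (- (l * a) + e)).
  { replace (- (l * a) + e) with (l * b) by lra.
    rewrite <- Hcb'. apply cos_decr_1; nra. }
  assert (Hs : (sin d')² = (sin e)²).
  { assert (H1 := sin2_cos2 d'). assert (H2 := sin2_cos2 e).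
    rewrite Hce in H2. lra. }
  apply Rsqr_eq in Hs.
  (* Modulo [2 PI], [d'] is [e] or [- e]; in the second case the pair is reflected. *)
  destruct Hs as [Hs | Hs].
  - exists (- (l * a)). split; [exact Hxa|].
    rewrite cos_plus, <- Hce, Hs, <- cos_plus. exact Hyb.
  - exists (l * a). split; [now rewrite cos_neg in Hxa|].
    rewrite cos_plus, <- Hce, Hs.
    rewrite cos_plus, cos_neg, sin_neg in Hyb. lra.
Qed.

(** Adding [PI] to both shifts negates the cosine of the second point, which reduces this to
    [closer_pair]. *)
Lemma farther_pair_l (b b' : R) : cos b' <= cos b ->
  forall x, exists x', cos x <= cos x' /\ cos (x' + b') <= cos (x + b).
Proof.
  intros Hb x.
  destruct (closer_pair (b + PI) (b' + PI)) with (x := x) as [x' [H1 H2]].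
  { rewrite !neg_cos. lra. }
  exists x'. split; [exact H1|].
  rewrite <- !Rplus_assoc, !neg_cos in H2. lra.
Qed.

(** Rotating both points by [PI] negates both cosines and reduces this to [farther_pair_l]. *)
Lemma farther_pair_r (b b' : R) : cos b' <= cos b ->
  forall x, exists x', cos x' <= cos x /\ cos (x + b) <= cos (x' + b').
Proof.
  intros Hb x.
  destruct (farther_pair_l b b' Hb (x + PI)) as [x' [H1 H2]].
  exists (x' + PI). rewrite neg_cos in H1 |- *.
  replace (x + PI + b) with (x + b + PI) in H2 by ring.
  replace (x' + PI + b') with (x' + b' + PI) by ring.
  rewrite neg_cos in H2 |- *. lra.
Qed.

(** * Functions monotone in [cos (2 * x)] and their oscillation *)

(** The parity of [k] does not matter: only the square of [cos (IZR k * PI)] enters, and it is 1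
    because the sine vanishes. *)
Lemma cos_double_shift (k : Z) (u : R) : cos (2 * (IZR k * PI + u)) = cos (2 * u).
Proof.
  assert (H0 : sin (IZR k * PI) = 0) by (apply sin_eq_0_1; now exists k).
  assert (H1 := sin2_cos2 (IZR k * PI)). rewrite H0 in H1. unfold Rsqr in H1.
  rewrite !cos_2a_sin, sin_plus, H0.
  replace (1 - 2 * _ * _) with
    (1 - 2 * (cos (IZR k * PI) * cos (IZR k * PI)) * sin u * sin u) by ring.
  replace (cos (IZR k * PI) * cos (IZR k * PI)) with 1 by lra. ring.
Qed.

Lemma cos_double_multiple (x : R) : multiple_PI x -> cos (2 * x) = 1.
Proof.
  intros [k ->]. replace (IZR k * PI) with (IZR k * PI + 0) by ring.
  rewrite cos_double_shift, Rmult_0_r. apply cos_0.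
Qed.

Lemma cos_double_odd_multiple (x : R) : odd_multiple_PI2 x -> cos (2 * x) = -1.
Proof.
  intros [k ->]. rewrite plus_IZR, mult_IZR.
  replace ((2 * IZR k + 1) * (PI / 2)) with (IZR k * PI + PI / 2) by field.
  rewrite cos_double_shift. replace (2 * (PI / 2)) with PI by field. apply cos_PI.
Qed.

Lemma consecutive_iff_ext (S S' : R -> Prop) (a b : R) :
  (forall x, S x <-> S' x) -> consecutive S a b -> consecutive S' a b.
Proof.
  intros HS [Ha [Hb [Hab Hc]]].
  repeat split; try (apply HS; assumption); try exact Hab.
  intros c Hc1 Hc2. apply (Hc c Hc1). now apply HS.
Qed.

Lemma half_PI_multiple (x : R) :
  (multiple_PI x \/ odd_multiple_PI2 x) <-> exists n : Z, x = IZR n * (PI / 2).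
Proof.
  split.
  - intros [[k ->] | [k ->]].
    + exists (2 * k)%Z. rewrite mult_IZR. field.
    + now exists (2 * k + 1)%Z.
  - intros [n ->].
    destruct (Z.Even_or_Odd n) as [[k ->] | [k ->]].
    + left. exists k. rewrite mult_IZR. field.
    + right. now exists k.
Qed.

(** The listed points are the multiples of [PI / 2], so consecutive ones have indices [n] and
    [n + 1]; the parity of [n] decides whether [cos (2 * x)] falls or rises between them. *)
Lemma consecutive_cos_double (a b : R) :
  consecutive (fun x => multiple_PI x \/ odd_multiple_PI2 x) a b ->
  (multiple_PI a /\ odd_multiple_PI2 b /\
   nonincreasing_on a b (fun x => cos (2 * x))) \/
  (odd_multiple_PI2 a /\ multiple_PI b /\
   nondecreasing_on a b (fun x => cos (2 * x))).
Proof.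
  intros Hcons.
  apply (consecutive_iff_ext _ _ _ _ half_PI_multiple) in Hcons.
  destruct Hcons as [[n ->] [[m ->] [Hlt Hno]]].
  assert (HPI := PI_RGT_0).
  assert (Hnm : (n < m)%Z) by (apply lt_IZR; nra).
  assert (Hm : m = (n + 1)%Z).
  { destruct (Z.eq_dec m (n + 1)) as [|Hne]; [assumption|exfalso].
    assert (Hm2 : (n + 1 < m)%Z) by lia. apply IZR_lt in Hm2.
    apply (Hno (IZR (n + 1) * (PI / 2))); [|now exists (n + 1)%Z].
    rewrite plus_IZR in *. split; nra. }
  subst m. clear Hlt Hno Hnm.
  destruct (Z.Even_or_Odd n) as [[k ->] | [k ->]]; rewrite !plus_IZR, !mult_IZR.
  - left. split; [exists k; field|].
    split; [exists k; rewrite plus_IZR, mult_IZR; field|].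
    intros x y Hx Hxy Hy.
    replace x with (IZR k * PI + (x - IZR k * PI)) by ring.
    replace y with (IZR k * PI + (y - IZR k * PI)) by ring.
    rewrite !cos_double_shift. apply cos_decr_1; lra.
  - right. split; [exists k; rewrite plus_IZR, mult_IZR; field|].
    split; [exists (k + 1)%Z; rewrite plus_IZR; field|].
    intros x y Hx Hxy Hy.
    replace x with (IZR k * PI + (x - IZR k * PI)) by ring.
    replace y with (IZR k * PI + (y - IZR k * PI)) by ring.
    rewrite !cos_double_shift. apply cos_incr_1; lra.
Qed.

(** This one property yields the period, the parity, the extremal points and the oscillation, for
    [Gmin] directly and for [Gmax] through its opposite. *)
Definition mono_cos_double (f : R -> R) : Prop :=
  forall x y, cos (2 * x) <= cos (2 * y) -> f x <= f y.

Lemma cos_double_mono_eq (f : R -> R) (x y : R) :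
  mono_cos_double f -> cos (2 * x) = cos (2 * y) -> f x = f y.
Proof. intros f_mono H. apply Rle_antisym; apply f_mono; lra. Qed.

Lemma cos_double_mono_periodic (f : R -> R) :
  mono_cos_double f -> periodic PI f.
Proof.
  intros f_mono x. apply (cos_double_mono_eq _ _ _ f_mono).
  replace (x + PI) with (IZR 1 * PI + x) by (simpl; ring). apply cos_double_shift.
Qed.

Lemma cos_double_mono_even (f : R -> R) :
  mono_cos_double f -> even_fun f.
Proof.
  intros f_mono x. apply (cos_double_mono_eq _ _ _ f_mono).
  replace (2 * - x) with (- (2 * x)) by ring. apply cos_neg.
Qed.

Lemma cos_double_mono_max (f : R -> R) (x : R) :
  mono_cos_double f -> multiple_PI x -> attains_max f x.
Proof.
  intros f_mono Hx y. apply f_mono. rewrite (cos_double_multiple x Hx). apply COS_bound.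
Qed.

Lemma cos_double_mono_min (f : R -> R) (x : R) :
  mono_cos_double f -> odd_multiple_PI2 x -> attains_min f x.
Proof.
  intros f_mono Hx y. apply f_mono. rewrite (cos_double_odd_multiple x Hx). apply COS_bound.
Qed.

Lemma cos_double_mono_oscillates (f : R -> R) :
  mono_cos_double f -> oscillates_monotonically f multiple_PI odd_multiple_PI2.
Proof.
  intros f_mono a b Hab.
  destruct (consecutive_cos_double a b Hab) as [[Ha [Hb Hm]] | [Ha [Hb Hm]]].
  - right. split; [|split; [now apply cos_double_mono_max | now apply cos_double_mono_min]].
    intros x y Hx Hxy Hy. apply f_mono. now apply Hm.
  - left. split; [|split; [now apply cos_double_mono_min | now apply cos_double_mono_max]].
    intros x y Hx Hxy Hy. apply f_mono. now apply Hm.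
Qed.

Lemma oscillates_opp (f : R -> R) (S T : R -> Prop) :
  oscillates_monotonically (fun x => - f x) S T -> oscillates_monotonically f T S.
Proof.
  intros Hf a b Hab.
  assert (Hopp : forall x y, - f x <= - f y -> f y <= f x) by (intros; lra).
  destruct (Hf a b) as [[Hm [Ha Hb]] | [Hm [Ha Hb]]].
  { apply consecutive_iff_ext with (2 := Hab). tauto. }
  - right. repeat split; repeat intro; apply Hopp; auto.
  - left. repeat split; repeat intro; apply Hopp; auto.
Qed.

(** * The closed form of the maximum over [alpha] *)

(** A quarter of the discriminant of [t ^ 2 - 2 * t * (1 + V * W * c) + (1 - V ^ 2) * (1 - W ^ 2)],
    whose larger root in [t] is [peak]. *)
Definition peak_disc (V W c : R) : R := (1 + V * W * c) ^ 2 - (1 - V ^ 2) * (1 - W ^ 2).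
Definition peak (V W c : R) : R := 1 + V * W * c + sqrt (peak_disc V W c).

(** This form shows the sign of the discriminant and bounds its square root below by [V + W * c]. *)
Lemma peak_disc_split (V W c : R) :
  peak_disc V W c = (V + W * c) ^ 2 + W ^ 2 * (1 - V ^ 2) * (1 - c ^ 2).
Proof. unfold peak_disc. ring. Qed.

Lemma peak_disc_nonneg (V W c : R) :
  0 <= V < 1 -> -1 <= c <= 1 -> 0 <= peak_disc V W c.
Proof.
  intros HV Hc. rewrite peak_disc_split.
  assert (0 <= W ^ 2 * (1 - V ^ 2) * (1 - c ^ 2)).
  { apply Rmult_le_pos; [apply Rmult_le_pos|]; nra. }
  assert (Hsq := pow2_ge_0 (V + W * c)). lra.
Qed.

Lemma linear_pos (V c : R) : 0 <= V < 1 -> -1 <= c <= 1 -> 0 < 1 + V * c.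
Proof. intros. nra. Qed.

Lemma peak_linear_pos (V W c : R) :
  0 <= V < 1 -> 0 <= W < 1 -> -1 <= c <= 1 -> 0 < 1 + V * W * c.
Proof. intros. apply linear_pos; [nra | assumption]. Qed.

Lemma peak_pos (V W c : R) :
  0 <= V < 1 -> 0 <= W < 1 -> -1 <= c <= 1 -> 0 < peak V W c.
Proof.
  intros HV HW Hc. unfold peak.
  assert (H := peak_linear_pos V W c HV HW Hc).
  assert (H' := sqrt_pos (peak_disc V W c)). lra.
Qed.

Lemma peak_mono (V W c d : R) :
  0 <= V < 1 -> 0 <= W < 1 -> -1 <= c -> c <= d -> d <= 1 ->
  peak V W c <= peak V W d.
Proof.
  intros HV HW Hc Hcd Hd. unfold peak.
  assert (H1 := peak_linear_pos V W c HV HW (conj Hc (Rle_trans _ _ _ Hcd Hd))).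
  assert (H2 : 1 + V * W * c <= 1 + V * W * d).
  { assert (0 <= V * W) by nra. nra. }
  assert (H3 : sqrt (peak_disc V W c) <= sqrt (peak_disc V W d)).
  { apply sqrt_le_1_alt. unfold peak_disc.
    assert ((1 + V * W * c) ^ 2 <= (1 + V * W * d) ^ 2) by (apply pow_incr; lra).
    lra. }
  lra.
Qed.

(** To the right of the vertex, a nonnegative value of the quadratic puts [t] beyond the larger
    root. Bounds on [peak] thus become polynomial inequalities. *)
Lemma peak_le (V W c t : R) :
  1 + V * W * c <= t ->
  0 <= t ^ 2 - 2 * t * (1 + V * W * c) + (1 - V ^ 2) * (1 - W ^ 2) ->
  peak V W c <= t.
Proof.
  intros H1 H2. unfold peak.
  assert (H3 : sqrt (peak_disc V W c) <= sqrt ((t - (1 + V * W * c)) ^ 2)).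
  { apply sqrt_le_1_alt. unfold peak_disc. nra. }
  rewrite sqrt_pow2 in H3; lra.
Qed.

(** A nonpositive value of the quadratic puts [t] between the two roots. *)
Lemma peak_ge (V W c t : R) :
  t ^ 2 - 2 * t * (1 + V * W * c) + (1 - V ^ 2) * (1 - W ^ 2) <= 0 ->
  t <= peak V W c.
Proof.
  intros H1. unfold peak.
  assert (H2 : sqrt ((t - (1 + V * W * c))²) <= sqrt (peak_disc V W c)).
  { apply sqrt_le_1_alt. unfold peak_disc, Rsqr. nra. }
  rewrite sqrt_Rsqr_abs in H2.
  assert (H3 := Rle_abs (t - (1 + V * W * c))). lra.
Qed.

Lemma peak_eq (V W c s : R) :
  0 <= s -> peak_disc V W c = s ^ 2 -> peak V W c = 1 + V * W * c + s.
Proof.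
  intros Hs HD. unfold peak. rewrite HD, sqrt_pow2 by exact Hs. reflexivity.
Qed.

(* [f_VW V W alpha x <= t] reads [1 - t + <u, (cos alpha, sin alpha)> <= 0] with
   [u = (V cos x + t W, - V sin x)]; so the maximum over [alpha] is the [t] with
   [|u| = t - 1], the larger root of
   [(1 - W^2) t^2 - 2 (1 + V W cos x) t + (1 - V^2) = 0]. *)
Lemma fmax_eq (V W x : R) :
  0 <= V < 1 -> 0 <= W < 1 -> fmax V W x = peak V W (cos x) / (1 - W ^ 2).
Proof.
  intros HV HW. apply max_of_eq.
  assert (HK : 0 < 1 - W ^ 2) by nra.
  assert (Hc := COS_bound x).
  assert (Hroot : (peak V W (cos x) - (1 + V * W * cos x)) ^ 2 = peak_disc V W (cos x)).
  { unfold peak.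
    replace (1 + V * W * cos x + sqrt (peak_disc V W (cos x)) - (1 + V * W * cos x))
      with (sqrt (peak_disc V W (cos x))) by ring.
    apply pow2_sqrt. now apply peak_disc_nonneg. }
  (* This is [1 <= t] for the [t] below; it ensures that the norm of [u] is [t - 1] and not
     [1 - t]. *)
  assert (Hpk : 1 - W ^ 2 <= peak V W (cos x)).
  { unfold peak. destruct (Rle_dec (V + W * cos x) 0) as [Hn | Hn].
    - assert (H0 := sqrt_pos (peak_disc V W (cos x))).
      assert (HVW : V <= W) by nra.
      assert (0 <= W * (W + V * cos x)) by (apply Rmult_le_pos; nra). lra.
    - assert (H0 : V + W * cos x <= sqrt (peak_disc V W (cos x))).
      { rewrite <- (sqrt_pow2 (V + W * cos x)) by lra. apply sqrt_le_1_alt.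
        rewrite peak_disc_split.
        assert (0 <= W ^ 2 * (1 - V ^ 2) * (1 - cos x ^ 2)).
        { apply Rmult_le_pos; [apply Rmult_le_pos|]; nra. }
        lra. }
      assert (0 <= W ^ 2 + V + W * cos x * (1 + V)); [|lra].
      destruct (Rle_dec V W) as [HVW | HVW]; [|apply Rnot_le_lt in HVW].
      + assert (0 <= (V + W * cos x) * (1 + V)) by (apply Rmult_le_pos; lra). nra.
      + assert (0 <= W * (1 + V) * (1 + cos x)) by (apply Rmult_le_pos; nra).
        assert (0 <= (1 - W) * (V - W)) by (apply Rmult_le_pos; lra). lra. }
  unfold peak_disc in Hroot.
  set (t := peak V W (cos x) / (1 - W ^ 2)).
  assert (Hpt : peak V W (cos x) = t * (1 - W ^ 2)) by (unfold t; field; lra).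
  rewrite Hpt in Hroot, Hpk. clearbody t. clear Hpt.
  assert (Ht : 1 <= t) by (apply (Rmult_le_reg_r (1 - W ^ 2)); lra).
  assert (Hx2 := sin2_cos2 x). unfold Rsqr in Hx2.
  assert (Hnorm : (V * cos x + t * W) ^ 2 + (V * sin x) ^ 2 = (t - 1) ^ 2).
  { apply (Rmult_eq_reg_r (1 - W ^ 2)); [|lra].
    replace ((V * sin x) ^ 2) with (V ^ 2 * (sin x * sin x)) by ring.
    replace (sin x * sin x) with (1 - cos x * cos x) by lra. lra. }
  assert (Hden : forall alpha, 0 < 1 - W * cos alpha).
  { intros alpha. assert (H0 := COS_bound alpha). nra. }
  assert (Hle : forall alpha, f_VW V W alpha x <= t).
  { intros alpha. unfold f_VW.
    apply (Rmult_le_reg_r (1 - W * cos alpha)); [auto|].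
    unfold Rdiv. rewrite Rmult_assoc, Rinv_l by (specialize (Hden alpha); lra).
    rewrite cos_plus.
    assert (Ha2 := sin2_cos2 alpha). unfold Rsqr in Ha2.
    (* Cauchy-Schwarz, by Lagrange's identity: the squares of the inner and cross products add up to
       the squared norm. *)
    assert (((V * cos x + t * W) * cos alpha - V * sin x * sin alpha) ^ 2
            <= (t - 1) ^ 2).
    { rewrite <- Hnorm.
      assert (H0 := pow2_ge_0 ((V * cos x + t * W) * sin alpha + V * sin x * cos alpha)).
      replace ((V * cos x + t * W) ^ 2 + (V * sin x) ^ 2) with
        (((V * cos x + t * W) ^ 2 + (V * sin x) ^ 2)
         * (sin alpha * sin alpha + cos alpha * cos alpha)) by (rewrite Ha2; ring).
      nra. }
    nra. }
  assert (Hex : exists alpha, t <= f_VW V W alpha x).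
  (* For [t = 1] the vector [u] vanishes and every [alpha] attains the maximum; otherwise [alpha] is
     the direction of [u]. *)
  { destruct (Req_dec (t - 1) 0) as [H0 | H0].
    - exists 0. rewrite H0 in Hnorm. unfold f_VW.
      apply (Rmult_le_reg_r (1 - W * cos 0)); [auto|].
      unfold Rdiv. rewrite Rmult_assoc, Rinv_l by (specialize (Hden 0); lra).
      rewrite Rplus_0_r, cos_0. nra.
    - destruct (unit_vector_angle ((V * cos x + t * W) / (t - 1)) (- (V * sin x) / (t - 1)))
        as [alpha [_ [Hca Hsa]]].
      { transitivity (((V * cos x + t * W) ^ 2 + (V * sin x) ^ 2) / (t - 1) ^ 2).
        - field. exact H0.
        - rewrite Hnorm. field. exact H0. }
      exists alpha. unfold f_VW.
      apply (Rmult_le_reg_r (1 - W * cos alpha)); [auto|].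
      unfold Rdiv. rewrite Rmult_assoc, Rinv_l by (specialize (Hden alpha); lra).
      rewrite cos_plus.
      assert (E : (V * cos x + t * W) * cos alpha - V * sin x * sin alpha = t - 1).
      { rewrite Hca, Hsa. apply (Rmult_eq_reg_r (t - 1)); [|exact H0].
        replace ((t - 1) * (t - 1)) with ((t - 1) ^ 2) by ring.
        rewrite <- Hnorm. field. exact H0. }
      lra. }
  destruct Hex as [alpha Halpha].
  exists alpha. split.
  - intros y. apply Rle_trans with t; auto.
  - now apply Rle_antisym.
Qed.

(** * Extrema of [H] over [x] and their monotonicity in [cos beta] *)

Lemma H_eq (V W x beta : R) : 0 <= V < 1 -> 0 <= W < 1 ->
  H V W x beta = peak V W (cos x) / (1 - W ^ 2) / (1 + V * cos (x + beta)).
Proof. intros HV HW. unfold H. now rewrite fmax_eq. Qed.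

Lemma H_le (V W x beta x' beta' : R) : 0 <= V < 1 -> 0 <= W < 1 ->
  cos x <= cos x' -> cos (x' + beta') <= cos (x + beta) ->
  H V W x beta <= H V W x' beta'.
Proof.
  intros HV HW H1 H2. rewrite !H_eq by assumption.
  assert (HK : 0 < 1 - W ^ 2) by nra.
  assert (Hx := COS_bound x). assert (Hx' := COS_bound x').
  assert (Hd := linear_pos V _ HV (COS_bound (x + beta))).
  assert (Hd' := linear_pos V _ HV (COS_bound (x' + beta'))).
  assert (Hp := peak_pos V W _ HV HW Hx).
  unfold Rdiv. apply Rmult_le_compat.
  - apply Rle_mult_inv_pos; lra.
  - apply Rlt_le, Rinv_0_lt_compat, Hd.
  - apply Rmult_le_compat_r; [apply Rlt_le, Rinv_0_lt_compat, HK|].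
    apply peak_mono; tauto.
  - apply Rinv_le_contravar; [exact Hd' | nra].
Qed.

Lemma H_continuity (V W beta : R) : 0 <= V < 1 -> 0 <= W < 1 ->
  continuity (fun x => H V W x beta).
Proof.
  intros HV HW x.
  assert (HK : 0 < 1 - W ^ 2) by nra.
  assert (Hd := linear_pos V _ HV (COS_bound (x + beta))).
  (* The radius 1 is arbitrary, as the two functions agree everywhere. *)
  apply continuity_pt_locally_ext with
    (f := fun y => peak V W (cos y) / (1 - W ^ 2) / (1 + V * cos (y + beta))) (a := 1).
  { lra. }
  { intros y _. symmetry. now apply H_eq. }
  apply (continuity_pt_div (fun y => peak V W (cos y) / (1 - W ^ 2))
           (fun y => 1 + V * cos (y + beta))); [|reg|lra].
  apply (continuity_pt_mult (fun y => peak V W (cos y)) (fun _ => / (1 - W ^ 2)));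
    [|reg].
  apply (continuity_pt_plus (fun y => 1 + V * W * cos y)
           (fun y => sqrt (peak_disc V W (cos y)))); [reg|].
  apply (continuity_pt_comp (fun y => peak_disc V W (cos y)) sqrt).
  - unfold peak_disc. reg.
  - apply continuity_pt_sqrt, peak_disc_nonneg; [exact HV | apply COS_bound].
Qed.

Lemma H_ext (V W beta x y : R) : 0 <= V < 1 -> 0 <= W < 1 ->
  cos x = cos y -> sin x = sin y -> H V W x beta = H V W y beta.
Proof.
  intros HV HW Hc Hs. rewrite !H_eq, !cos_plus, Hc, Hs by assumption. reflexivity.
Qed.

(** Attainment by compactness is what gives the choice in [max_of] its meaning. *)
Lemma Hmax_spec (V W beta : R) : 0 <= V < 1 -> 0 <= W < 1 ->
  is_max (fun x => H V W x beta) (Hmax V W beta).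
Proof.
  intros HV HW.
  destruct (circle_is_max (fun x => H V W x beta)) as [m Hm].
  - now apply H_continuity.
  - intros x y. now apply H_ext.
  - unfold Hmax. now rewrite (max_of_eq _ _ Hm).
Qed.

Lemma Hmin_spec (V W beta : R) : 0 <= V < 1 -> 0 <= W < 1 ->
  is_min (fun x => H V W x beta) (Hmin V W beta).
Proof.
  intros HV HW.
  destruct (circle_is_min (fun x => H V W x beta)) as [m Hm].
  - now apply H_continuity.
  - intros x y. now apply H_ext.
  - unfold Hmin. now rewrite (min_of_eq _ _ Hm).
Qed.

(** A maximiser for [beta] is moved to a competitor for [beta'] with a numerator at least as large
    and a denominator at most as large. *)
Lemma Hmax_anti (V W beta beta' : R) : 0 <= V < 1 -> 0 <= W < 1 ->
  cos beta' <= cos beta -> Hmax V W beta <= Hmax V W beta'.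
Proof.
  intros HV HW Hb.
  destruct (Hmax_spec V W beta HV HW) as [x [_ <-]].
  destruct (Hmax_spec V W beta' HV HW) as [y [Hy <-]].
  destruct (farther_pair_l beta beta' Hb x) as [x' [H1 H2]].
  apply Rle_trans with (H V W x' beta'); [now apply H_le | exact (Hy x')].
Qed.

Lemma Hmin_mono (V W beta beta' : R) : 0 <= V < 1 -> 0 <= W < 1 ->
  cos beta' <= cos beta -> Hmin V W beta' <= Hmin V W beta.
Proof.
  intros HV HW Hb.
  destruct (Hmin_spec V W beta HV HW) as [x [_ <-]].
  destruct (Hmin_spec V W beta' HV HW) as [y [Hy <-]].
  destruct (farther_pair_r beta beta' Hb x) as [x' [H1 H2]].
  apply Rle_trans with (H V W x' beta'); [exact (Hy x') | now apply H_le].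
Qed.

Lemma Gmax_anti (V W x y : R) : 0 <= V < 1 -> 0 <= W < 1 ->
  cos (2 * x) <= cos (2 * y) -> Gmax V W y <= Gmax V W x.
Proof.
  intros HV HW Hxy. apply sqrt_le_1_alt, Rmult_le_compat_l; [nra|].
  now apply Hmax_anti.
Qed.

Lemma Gmin_mono (V W : R) : 0 <= V < 1 -> 0 <= W < 1 -> mono_cos_double (Gmin V W).
Proof.
  intros HV HW x y Hxy. apply sqrt_le_1_alt, Rmult_le_compat_l; [nra|].
  now apply Hmin_mono.
Qed.

(** * Values of [Gmax] and [Gmin] at [0] and [PI / 2] *)

(** The factor [1 - W ^ 2] cancels, so the squared value is the maximum of [peak] over twice the
    denominator: a bound with contact at one [x] suffices. *)
Lemma Gmax_eq (V W gamma v x : R) : 0 <= V < 1 -> 0 <= W < 1 ->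
  (forall y, peak V W (cos y) <= 2 * v * (1 + V * cos (y + 2 * gamma))) ->
  peak V W (cos x) = 2 * v * (1 + V * cos (x + 2 * gamma)) ->
  Gmax V W gamma = sqrt v.
Proof.
  intros HV HW Hle Heq.
  assert (HK : 0 < 1 - W ^ 2) by nra.
  assert (Hd : forall y, 0 < 1 + V * cos (y + 2 * gamma)).
  { intros y. exact (linear_pos V _ HV (COS_bound _)). }
  assert (Hx : H V W x (2 * gamma) = 2 * v / (1 - W ^ 2)).
  { rewrite H_eq, Heq by assumption. specialize (Hd x). field. lra. }
  unfold Gmax, Hmax. rewrite (max_of_eq _ (2 * v / (1 - W ^ 2))).
  { f_equal. field. lra. }
  exists x. split; [|exact Hx].
  intros y. rewrite Hx, H_eq by assumption.
  specialize (Hd y). specialize (Hle y).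
  apply (Rmult_le_reg_r ((1 - W ^ 2) * (1 + V * cos (y + 2 * gamma)))).
  { now apply Rmult_lt_0_compat. }
  replace (peak V W (cos y) / _ / _ * _) with (peak V W (cos y)) by (field; lra).
  replace (2 * v / _ * _) with (2 * v * (1 + V * cos (y + 2 * gamma))) by (field; lra).
  exact Hle.
Qed.

Lemma Gmin_eq (V W gamma v x : R) : 0 <= V < 1 -> 0 <= W < 1 ->
  (forall y, 2 * v * (1 + V * cos (y + 2 * gamma)) <= peak V W (cos y)) ->
  peak V W (cos x) = 2 * v * (1 + V * cos (x + 2 * gamma)) ->
  Gmin V W gamma = sqrt v.
Proof.
  intros HV HW Hle Heq.
  assert (HK : 0 < 1 - W ^ 2) by nra.
  assert (Hd : forall y, 0 < 1 + V * cos (y + 2 * gamma)).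
  { intros y. exact (linear_pos V _ HV (COS_bound _)). }
  assert (Hx : H V W x (2 * gamma) = 2 * v / (1 - W ^ 2)).
  { rewrite H_eq, Heq by assumption. specialize (Hd x). field. lra. }
  unfold Gmin, Hmin. rewrite (min_of_eq _ (2 * v / (1 - W ^ 2))).
  { f_equal. field. lra. }
  exists x. split; [|exact Hx].
  intros y. rewrite Hx, H_eq by assumption.
  specialize (Hd y). specialize (Hle y).
  apply (Rmult_le_reg_r ((1 - W ^ 2) * (1 + V * cos (y + 2 * gamma)))).
  { now apply Rmult_lt_0_compat. }
  replace (peak V W (cos y) / _ / _ * _) with (peak V W (cos y)) by (field; lra).
  replace (2 * v / _ * _) with (2 * v * (1 + V * cos (y + 2 * gamma))) by (field; lra).
  exact Hle.
Qed.

Lemma peak_1 (V W : R) : 0 <= V < 1 -> 0 <= W < 1 ->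
  peak V W 1 = (1 + V) * (1 + W).
Proof.
  intros HV HW. rewrite (peak_eq V W 1 (V + W)); unfold peak_disc; [ring | lra | ring].
Qed.

(** At [c = -1] the discriminant is [(V - W) ^ 2]; the sign of [V - W] causes the two cases for the
    minimum of [Gmin]. *)
Lemma peak_opp1_ge (V W : R) : W <= V -> peak V W (-1) = (1 + V) * (1 - W).
Proof.
  intros HVW. rewrite (peak_eq V W (-1) (V - W)); unfold peak_disc; [ring | lra | ring].
Qed.

Lemma peak_opp1_le (V W : R) : V <= W -> peak V W (-1) = (1 - V) * (1 + W).
Proof.
  intros HVW. rewrite (peak_eq V W (-1) (W - V)); unfold peak_disc; [ring | lra | ring].
Qed.

(** At shift [PI] the denominator is [1 - V * cos x], so [cos x = 1] makes [peak] largest and the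
    denominator smallest at once. *)
Lemma Gmax_half_PI (V W : R) : 0 <= V < 1 -> 0 <= W < 1 ->
  Gmax V W (PI / 2) = sqrt ((1 + V) * (1 + W) / (2 * (1 - V))).
Proof.
  intros HV HW.
  apply Gmax_eq with (x := 0); auto; replace (2 * (PI / 2)) with PI by field.
  - intros y. rewrite neg_cos.
    assert (Hy := COS_bound y).
    apply Rle_trans with (peak V W 1); [apply peak_mono; tauto || lra|].
    rewrite peak_1 by assumption.
    apply (Rmult_le_reg_r (1 - V)); [lra|].
    replace (2 * _ * _ * _) with ((1 + V) * (1 + W) * (1 + V * - cos y)) by (field; lra).
    apply Rmult_le_compat_l; nra.
  - rewrite neg_cos, cos_0, peak_1 by assumption. field. lra.
Qed.

Lemma Gmin_half_PI (V W v : R) : 0 <= V < 1 -> 0 <= W < 1 ->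
  0 <= v -> peak V W (-1) = 2 * v * (1 + V) -> Gmin V W (PI / 2) = sqrt v.
Proof.
  intros HV HW Hv Hpk.
  apply Gmin_eq with (x := PI); auto; replace (2 * (PI / 2)) with PI by field.
  - intros y. rewrite neg_cos.
    assert (Hy := COS_bound y).
    apply Rle_trans with (peak V W (-1)); [|apply peak_mono; tauto || lra].
    rewrite Hpk. apply Rmult_le_compat_l; nra.
  - rewrite neg_cos, cos_PI, Hpk. f_equal. ring.
Qed.

Lemma Gmin_0 (V W : R) : 0 <= V < 1 -> 0 <= W < 1 ->
  Gmin V W 0 = sqrt ((1 + W) / 2).
Proof.
  intros HV HW.
  apply Gmin_eq with (x := 0); auto; rewrite Rmult_0_r.
  - intros y. rewrite Rplus_0_r. assert (Hy := COS_bound y).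
    apply peak_ge.
    replace (2 * ((1 + W) / 2) * (1 + V * cos y)) with
      ((1 + W) * (1 + V * cos y)) by field.
    (* The factor [1 - cos y ^ 2] shows that the bound lies between the roots. *)
    replace (_ + _) with
      (- ((1 + W) * (1 - W) * V ^ 2 * ((1 - cos y) * (1 + cos y)))) by ring.
    assert (0 <= (1 + W) * (1 - W) * V ^ 2 * ((1 - cos y) * (1 + cos y))); [|lra].
    assert (0 <= V ^ 2) by apply pow2_ge_0.
    apply Rmult_le_pos; [apply Rmult_le_pos; nra | apply Rmult_le_pos; lra].
  - rewrite Rplus_0_r, cos_0, peak_1 by assumption. field.
Qed.

(* [peak V W c <= m (1 + V c)] with equality at [c = - q]: the quadratic in [c]
   provided by [peak_le] has the double root [- q]. *)
Lemma Gmax_0_small (V W q : R) : 0 <= V < 1 -> 0 <= W < 1 -> 0 <= q <= 1 ->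
  2 * W * q = V * (1 + W) ->
  Gmax V W 0 = sqrt ((1 - V ^ 2) * (1 + W) / (2 * (1 - q * V))).
Proof.
  intros HV HW Hq HqV.
  assert (HqV1 : 0 < 1 - q * V) by nra.
  set (m := (1 - V ^ 2) * (1 + W) / (1 - q * V)).
  replace ((1 - V ^ 2) * (1 + W) / (2 * (1 - q * V))) with (m / 2) by (unfold m; field; lra).
  (* Since [W] may vanish, [V] is eliminated in favour of [q] and not conversely. *)
  assert (HVW : V = 2 * W * q / (1 + W)) by (rewrite HqV; field; lra).
  assert (Hm : m * (1 - q * V) = (1 - V ^ 2) * (1 + W)) by (unfold m; field; lra).
  (* The quadratic has leading coefficient [m * (m - 2 * W) * V ^ 2] in [c], whence the interest in
     this sign. *)
  assert (HmW : m - 2 * W = (1 - W) / (1 - q * V)).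
  { unfold m. apply (Rmult_eq_reg_r (1 - q * V)); [|lra].
    replace (((1 - V ^ 2) * (1 + W) / (1 - q * V) - 2 * W) * (1 - q * V)) with
      ((1 - V ^ 2) * (1 + W) - 2 * W + 2 * W * q * V) by (field; lra).
    rewrite HqV. field. lra. }
  assert (HmW0 : 0 < m - 2 * W).
  { rewrite HmW. apply Rdiv_lt_0_compat; lra. }
  apply Gmax_eq with (x := acos (- q)); auto; rewrite Rmult_0_r.
  - intros y. rewrite Rplus_0_r. assert (Hy := COS_bound y).
    set (c := cos y) in *. clearbody c.
    replace (2 * (m / 2) * (1 + V * c)) with (m * (1 + V * c)) by field.
    apply peak_le.
    (* The vertex condition is affine in [c] with slope [V * (m - W)], so it is checked at [c = -1].
       There the elimination of [V] leaves a sum of visibly nonnegative products. *)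
    + assert (Hend : 1 - V * W <= m * (1 - V)).
      { apply (Rmult_le_reg_r (1 - q * V)); [exact HqV1|].
        replace (m * (1 - V) * (1 - q * V)) with (m * (1 - q * V) * (1 - V)) by ring.
        rewrite Hm.
        assert (Hdiff : (1 - V ^ 2) * (1 + W) * (1 - V) - (1 - V * W) * (1 - q * V)
          = W * ((1 - W) ^ 2 * (q ^ 2 + (1 - q) ^ 2)
                 + 2 * (1 - q) * W * (1 - W) * (1 + (1 - q))
                 + 4 * W ^ 2 * (1 - q) ^ 2 * (1 + q)) / (1 + W) ^ 2).
        { rewrite HVW. field. lra. }
        assert (0 <= W * ((1 - W) ^ 2 * (q ^ 2 + (1 - q) ^ 2)
                 + 2 * (1 - q) * W * (1 - W) * (1 + (1 - q))
                 + 4 * W ^ 2 * (1 - q) ^ 2 * (1 + q)) / (1 + W) ^ 2); [|lra].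
        apply Rle_mult_inv_pos; [|apply pow_lt; lra].
        assert (Hsq := pow2_ge_0 q). assert (Hsq' := pow2_ge_0 (1 - q)).
        assert (HsW := pow2_ge_0 W). assert (HsW' := pow2_ge_0 (1 - W)).
        apply Rmult_le_pos; [lra|].
        repeat apply Rplus_le_le_0_compat; repeat apply Rmult_le_pos; lra. }
      assert (0 <= V * (1 + c) * (m - W)) by (apply Rmult_le_pos; nra). lra.
    + replace (_ + _) with (m * (m - 2 * W) * (V * (c + q)) ^ 2).
      { assert (0 <= (V * (c + q)) ^ 2) by apply pow2_ge_0.
        assert (0 < m * (m - 2 * W)) by nra. nra. }
      assert (Hden : 0 < 1 + W - q * (2 * W * q)) by (rewrite HqV; nra).
      rewrite HmW. unfold m. rewrite HVW in HqV1 |- *. field. lra.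
  - rewrite Rplus_0_r, cos_acos by lra.
    (* Contact forces the square root to be [(1 - V ^ 2) * (1 + W) - (1 - V * W * q)], simplified
       here by [HqV]. *)
    rewrite (peak_eq V W (- q) (W - V ^ 2 * (1 + W) / 2)).
    + replace (2 * (m / 2) * (1 + V * - q)) with (m * (1 - q * V)) by field.
      rewrite Hm.
      replace (V * W * - q) with (- (V * (2 * W * q) / 2)) by field.
      rewrite HqV. field.
    + assert (V ^ 2 * (1 + W) <= 2 * W); [|lra].
      replace (V ^ 2 * (1 + W)) with (V * (V * (1 + W))) by ring.
      rewrite <- HqV. assert (0 <= V * q <= 1) by nra. nra.
    + unfold peak_disc.
      replace (V * W * - q) with (- (V * (2 * W * q) / 2)) by field.
      rewrite HqV. field.
Qed.

(** Contact is now at the end [c = -1]. In powers of [e = V * (1 + c)] the quadratic has no constant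
    term and nonnegative coefficients, the linear one by the hypothesis [2 * W <= V * (1 + W)]. *)
Lemma Gmax_0_large (V W : R) : 0 <= V < 1 -> 0 <= W < 1 ->
  2 * W <= V * (1 + W) ->
  Gmax V W 0 = sqrt ((1 + V) * (1 - W) / (2 * (1 - V))).
Proof.
  intros HV HW HVW.
  assert (HWV : W <= V) by nra.
  set (m := (1 + V) * (1 - W) / (1 - V)).
  replace ((1 + V) * (1 - W) / (2 * (1 - V))) with (m / 2) by (unfold m; field; lra).
  assert (Hm : m * (1 - V) = (1 + V) * (1 - W)) by (unfold m; field; lra).
  assert (Hm0 : 0 < m) by nra.
  apply Gmax_eq with (x := PI); auto; rewrite Rmult_0_r.
  - intros y. rewrite Rplus_0_r. assert (Hy := COS_bound y).
    set (c := cos y) in *. clearbody c.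
    replace (2 * (m / 2) * (1 + V * c)) with (m * (1 + V * c)) by field.
    assert (HmW : 0 <= m - 2 * W).
    { apply (Rmult_le_reg_r (1 - V)); [lra|].
      rewrite Rmult_minus_distr_r, Hm. nra. }
    apply peak_le.
    + replace (m * (1 + V * c)) with (m * (1 - V) + m * V * (1 + c)) by ring.
      rewrite Hm.
      assert (0 <= V * (1 + c) * (m - W)) by (apply Rmult_le_pos; nra). lra.
    + set (e := V * (1 + c)).
      assert (He : 0 <= e) by (unfold e; nra).
      replace (m * (1 + V * c)) with (m * (1 - V) + m * e) by (unfold e; ring).
      replace (1 + V * W * c) with (1 - V * W + W * e) by (unfold e; ring).
      replace (_ + _) with (m * (m - 2 * W) * e ^ 2
        + 2 * m * (m * (1 - V) - (1 - V * W) - W * (1 - V)) * e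
        + ((m * (1 - V)) ^ 2 - 2 * (m * (1 - V)) * (1 - V * W)
           + (1 - V ^ 2) * (1 - W ^ 2))) by ring.
      rewrite Hm.
      replace ((1 + V) * (1 - W) - (1 - V * W) - W * (1 - V)) with
        (V * (1 + W) - 2 * W) by ring.
      replace (((1 + V) * (1 - W)) ^ 2 - _ + _) with 0 by ring.
      assert (0 <= m * (m - 2 * W) * e ^ 2).
      { apply Rmult_le_pos; [nra | apply pow2_ge_0]. }
      assert (0 <= 2 * m * (V * (1 + W) - 2 * W) * e).
      { apply Rmult_le_pos; [apply Rmult_le_pos|]; lra. }
      lra.
  - rewrite Rplus_0_r, cos_PI, peak_opp1_ge by exact HWV.
    replace (2 * (m / 2) * (1 + V * -1)) with (m * (1 - V)) by field. lra.
Qed.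

Theorem theorem24 :
  forall (V1 W1 : R) (Q1 : Rbar),
    0 <= V1 < 1 -> 0 <= W1 < 1 -> is_Q1 V1 W1 Q1 ->
    (periodic PI (Gmax V1 W1) /\
     even_fun (Gmax V1 W1) /\
     oscillates_monotonically (Gmax V1 W1) odd_multiple_PI2 multiple_PI /\
     is_max (Gmax V1 W1) (sqrt ((1 + V1) * (1 + W1) / (2 * (1 - V1)))) /\
     (Rbar_le Q1 (Finite 1) ->
      is_min (Gmax V1 W1)
        (sqrt ((1 - V1 ^ 2) * (1 + W1) / (2 * (1 - real Q1 * V1))))) /\
     (Rbar_le (Finite 1) Q1 ->
      is_min (Gmax V1 W1) (sqrt ((1 + V1) * (1 - W1) / (2 * (1 - V1))))) /\
     (forall gamma, odd_multiple_PI2 gamma -> attains_max (Gmax V1 W1) gamma) /\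
     (forall gamma, multiple_PI gamma -> attains_min (Gmax V1 W1) gamma))
    /\
    (periodic PI (Gmin V1 W1) /\
     even_fun (Gmin V1 W1) /\
     oscillates_monotonically (Gmin V1 W1) multiple_PI odd_multiple_PI2 /\
     is_max (Gmin V1 W1) (sqrt ((1 + W1) / 2)) /\
     (V1 <= W1 ->
      is_min (Gmin V1 W1) (sqrt ((1 - V1) * (1 + W1) / (2 * (1 + V1))))) /\
     (W1 <= V1 -> is_min (Gmin V1 W1) (sqrt ((1 - W1) / 2))) /\
     (forall gamma, multiple_PI gamma -> attains_max (Gmin V1 W1) gamma) /\
     (forall gamma, odd_multiple_PI2 gamma -> attains_min (Gmin V1 W1) gamma)).
Proof.
  intros V W Q HV HW HQ.
  assert (Hodd : odd_multiple_PI2 (PI / 2)) by (exists 0%Z; simpl; ring).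
  assert (Hmul : multiple_PI 0) by (exists 0%Z; simpl; ring).
  assert (Hmin := Gmin_mono V W HV HW).
  assert (Hopp : mono_cos_double (fun x => - Gmax V W x)).
  { intros x y Hxy. apply Ropp_le_contravar. now apply Gmax_anti. }
  assert (Hattmax : forall x, odd_multiple_PI2 x -> attains_max (Gmax V W) x).
  { intros x Hx y. apply Ropp_le_cancel. now apply (cos_double_mono_min _ _ Hopp). }
  assert (Hattmin : forall x, multiple_PI x -> attains_min (Gmax V W) x).
  { intros x Hx y. apply Ropp_le_cancel. now apply (cos_double_mono_max _ _ Hopp). }
  split; repeat apply conj.
  - intros x. apply Ropp_eq_reg. apply (cos_double_mono_periodic _ Hopp).
  - intros x. apply Ropp_eq_reg. apply (cos_double_mono_even _ Hopp).
  - apply oscillates_opp. now apply cos_double_mono_oscillates.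
  - exists (PI / 2). split; [auto | now apply Gmax_half_PI].
  - intros HQ1. exists 0. split; [auto|].
    destruct (Req_dec W 0) as [HW0 | HW0].
    + destruct (Req_dec V 0) as [HV0 | HV0].
      (* For [V = W = 0] the value of [Q] is arbitrary, but it enters only through its product with
         [V], so [q = 0] can replace it. *)
      * rewrite (Gmax_0_small V W 0); [|assumption|assumption|lra|rewrite HV0; ring].
        rewrite HV0. do 2 f_equal. ring.
      * rewrite (proj2 HQ HW0 HV0) in HQ1. contradiction.
    + rewrite (proj1 HQ HW0) in HQ1 |- *. simpl in HQ1 |- *.
      apply Gmax_0_small; auto.
      * split; [|exact HQ1]. apply Rle_mult_inv_pos; nra.
      * field. exact HW0.
  - intros HQ1. exists 0. split; [auto|].
    apply Gmax_0_large; auto.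
    destruct (Req_dec W 0) as [HW0 | HW0]; [rewrite HW0; lra|].
    rewrite (proj1 HQ HW0) in HQ1. simpl in HQ1.
    apply (Rmult_le_compat_r (2 * W)) in HQ1; [|lra].
    replace (V * (1 + W) / (2 * W) * (2 * W)) with (V * (1 + W)) in HQ1 by (field; exact HW0).
    lra.
  - exact Hattmax.
  - exact Hattmin.
  - now apply cos_double_mono_periodic.
  - now apply cos_double_mono_even.
  - now apply cos_double_mono_oscillates.
  - exists 0. split; [now apply cos_double_mono_max | now apply Gmin_0].
  - intros HVW. exists (PI / 2). split; [now apply cos_double_mono_min|].
    apply Gmin_half_PI; auto.
    + apply Rle_mult_inv_pos; [apply Rmult_le_pos; lra | lra].
    + rewrite peak_opp1_le by exact HVW. field. lra.
  - intros HWV. exists (PI / 2). split; [now apply cos_double_mono_min|].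
    apply Gmin_half_PI; auto; [lra|].
    rewrite peak_opp1_ge by exact HWV. field.
  - intros x Hx. now apply cos_double_mono_max.
  - intros x Hx. now apply cos_double_mono_min.
Qed.
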